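(* The determinant of the square matrix over $\mathbb Z/2$ represented by a finite directed graph is definable in FP+Card. That is, there is an FP+Card sentence which holds in a finite directed graph $\langle I,E\rangle$ (with $E\subseteq I\times I$, loops allowed) exactly when the $I$-square matrix $M$ over $\mathbb Z/2$ with $M(i,j)=1\iff (i,j)\in E$ has determinant $1$.
   Context: For a finite set $I$, an $I$-square matrix is a function $M:I\times I\to\mathbb Z/2$; its determinant is that of the ordinary matrix obtained by choosing any linear ordering of $I$ for both rows and columns, and is independent of the ordering. Truth values are identified with the possible determinant values $0,1$. FP+Card: each input structure with universe $A$ is extended to a two-sorted structure whose second sort is $\{0,\dots,|A|\}$ with successor; formulas are first-order formulas extended by the inflationary fixpoint operator (on either or both sorts) and counting terms $(\sharp x)\varphi(x)$ giving the number of $x$ satisfying $\varphi$. *)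

(* Defs.v *)
From HB Require Import structures.
From mathcomp Require Import all_boot all_order all_fingroup all_algebra.


Set Implicit Arguments.
Unset Strict Implicit.
Unset Printing Implicit Defensive.

Import GRing.Theory.
Local Open Scope ring_scope.

Definition detI (R : comNzRingType) (I : finType) (M : I -> I -> R) : R :=
  \det (\matrix_(i < #|I|, j < #|I|) M (enum_val i) (enum_val j)).

(* [detI] uses the ordering [enum I]; any other ordering, used for both rows
   and columns, gives the same value. *)
Lemma detI_ordering (R : comNzRingType) (I : finType) (M : I -> I -> R)
    (f : 'I_#|I| -> I) :
  bijective f -> \det (\matrix_(i, j) M (f i) (f j)) = detI M.
Proof.
case=> g fK gK.
have inj_s : injective (fun i : 'I_#|I| => enum_rank (f i)).
  by move=> i j /enum_rank_inj /(can_inj fK).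
set s := perm inj_s.
have -> : \matrix_(i, j) M (f i) (f j) =
    row_perm s (col_perm s (\matrix_(i, j) M (enum_val i) (enum_val j))).
  by apply/matrixP=> i j; rewrite !mxE !permE !enum_rankK.
rewrite row_permE col_permE !det_mulmx !det_perm odd_permV /detI.
by rewrite mulrC -mulrA -signr_addb addbb mulr1.
Qed.

(* FP+Card over the vocabulary of directed graphs.
   [Pt] is the sort of the universe [I] of the input structure, [Nu] the sort
   of the numbers 0, ..., #|I|. *)
Inductive fpc_sort := Pt | Nu.

(* Well-sorted de Bruijn variables: [var G s] is the type of positions of [s]
   in the context [G]. *)
Inductive var (T : Type) : seq T -> T -> Type :=
| VZ s G : var (s :: G) s
| VS s s' G : var G s -> var (s' :: G) s.

(* Formulas [fpc_form R G] and terms [fpc_term R G s] have their free individual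
   variables in [G] and their free relation variables in [R]; the type of a
   relation variable is the list of the sorts of its arguments. [FSucc t u]
   means u = t + 1, a relation since #|I| has no successor. *)
Inductive fpc_form (R : seq (seq fpc_sort)) (G : seq fpc_sort) : Type :=
| FEdge of fpc_term R G Pt & fpc_term R G Pt
| FSucc of fpc_term R G Nu & fpc_term R G Nu
| FEq s of fpc_term R G s & fpc_term R G s
| FRel a of var R a & (forall s, var a s -> fpc_term R G s)
| FNot of fpc_form R G
| FAnd of fpc_form R G & fpc_form R G
| FOr of fpc_form R G & fpc_form R G
| FEx s of fpc_form R (s :: G)
| FAll s of fpc_form R (s :: G)
(* [FIfp phi ts] is [IFP_(X, xs) phi](ts): [phi] is in the scope of the new
   relation variable X of type [a] and of the new variables xs of sorts [a]. *)
| FIfp a of fpc_form (a :: R) (a ++ G) & (forall s, var a s -> fpc_term R G s)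
with fpc_term (R : seq (seq fpc_sort)) (G : seq fpc_sort) : fpc_sort -> Type :=
| TVar s of var G s : fpc_term R G s
(* (# x) phi, with x of sort [Pt], so that the value is at most #|I|. *)
| TCard of fpc_form R (Pt :: G) : fpc_term R G Nu.

Definition fpc_sentence := fpc_form [::] [::].

Definition sdom (I : finType) (s : fpc_sort) : finType :=
  match s with Pt => I | Nu => 'I_#|I|.+1 end.

Fixpoint env (I : finType) (G : seq fpc_sort) : finType :=
  match G with
  | [::] => unit
  | s :: G' => (sdom I s * env I G')%type
  end.

Fixpoint renv (I : finType) (R : seq (seq fpc_sort)) : Type :=
  match R with
  | [::] => unit
  | a :: R' => ({set env I a} * renv I R')%type
  end.

Fixpoint lookup (I : finType) G s (x : var G s) : env I G -> sdom I s :=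
  match x in var G s return env I G -> sdom I s with
  | VZ _ _ => fun e => e.1
  | VS _ _ _ y => fun e => lookup y e.2
  end.

Fixpoint rlookup (I : finType) R a (x : var R a) : renv I R -> {set env I a} :=
  match x in var R a return renv I R -> {set env I a} with
  | VZ _ _ => fun r => r.1
  | VS _ _ _ y => fun r => rlookup y r.2
  end.

Fixpoint env_cat (I : finType) a G : env I a -> env I G -> env I (a ++ G) :=
  match a return env I a -> env I G -> env I (a ++ G) with
  | [::] => fun _ e => e
  | s :: a' => fun t e => (t.1, env_cat t.2 e)
  end.

Fixpoint env_tab (I : finType) a : (forall s, var a s -> sdom I s) -> env I a :=
  match a return (forall s, var a s -> sdom I s) -> env I a with
  | [::] => fun _ => tt
  | s :: a' => fun f => (f s (VZ s a'), env_tab (fun s' x => f s' (VS s x)))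
  end.

(* The stages X_0 = set0, X_(n+1) = X_n :|: F X_n are increasing, hence
   stationary from n = #|T| on (see [ifp_stable]). *)
Definition ifp_stage (T : finType) (F : {set T} -> {set T}) (n : nat) : {set T} :=
  iter n (fun X => X :|: F X) set0.

Definition ifp (T : finType) (F : {set T} -> {set T}) : {set T} :=
  ifp_stage F #|T|.

Lemma ifp_stable (T : finType) (F : {set T} -> {set T}) (n : nat) :
  (#|T| <= n)%N -> ifp_stage F n = ifp F.
Proof.
have stageS k : ifp_stage F k.+1 = ifp_stage F k :|: F (ifp_stage F k) by [].
have stat k m : ifp_stage F k.+1 = ifp_stage F k ->
    ifp_stage F (m + k) = ifp_stage F k.
  by move=> e; elim: m => // m IH; rewrite addSn stageS IH -stageS.
have grow k : ifp_stage F k.+1 = ifp_stage F k \/ (k < #|ifp_stage F k.+1|)%N.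
  elim: k => [|k [e|lt]].
  - have [->|ne] := eqVneq (ifp_stage F 1) set0; first by left.
    by right; rewrite card_gt0.
  - by left; rewrite stageS e -stageS.
  have [e|ne] := eqVneq (ifp_stage F k.+2) (ifp_stage F k.+1); first by left.
  right; apply: leq_ltn_trans lt _; apply: proper_card.
  by rewrite properEneq eq_sym ne stageS subsetUl.
have e : ifp_stage F #|T|.+1 = ifp_stage F #|T|.
  by case: (grow #|T|) => // lt; have:= max_card (mem (ifp_stage F #|T|.+1));
     rewrite leqNgt lt.
by move=> le; rewrite -(subnK le) (stat _ _ e).
Qed.

Definition count_pt (I : finType) (P : pred I) : sdom I Nu :=
  Ordinal (max_card P : (#|P| < #|I|.+1)%N).

Section Eval.
Variables (I : finType) (E : rel I).

Fixpoint fpc_eval R G (phi : fpc_form R G) (r : renv I R) (e : env I G)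
    {struct phi} : bool :=
  match phi with
  | FEdge t u => E (fpc_teval t r e) (fpc_teval u r e)
  | FSucc t u =>
      (fpc_teval u r e : 'I_#|I|.+1) == (fpc_teval t r e : 'I_#|I|.+1).+1 :> nat
  | FEq _ t u => fpc_teval t r e == fpc_teval u r e
  | FRel _ X ts => env_tab (fun s x => fpc_teval (ts s x) r e) \in rlookup X r
  | FNot p => ~~ fpc_eval p r e
  | FAnd p q => fpc_eval p r e && fpc_eval q r e
  | FOr p q => fpc_eval p r e || fpc_eval q r e
  | FEx s p => [exists d : sdom I s, @fpc_eval R (s :: G) p r (d, e)]
  | FAll s p => [forall d : sdom I s, @fpc_eval R (s :: G) p r (d, e)]
  | FIfp a p ts =>
      env_tab (fun s x => fpc_teval (ts s x) r e) \in
        ifp (fun X : {set env I a} =>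
               [set t | @fpc_eval (a :: R) (a ++ G) p (X, r) (env_cat t e)])
  end
with fpc_teval R G s (t : fpc_term R G s) (r : renv I R) (e : env I G)
    {struct t} : sdom I s :=
  match t in fpc_term _ _ s return sdom I s with
  | TVar _ x => lookup x e
  | TCard p => count_pt (fun d => @fpc_eval R (Pt :: G) p r (d, e))
  end.

Definition fpc_holds (phi : fpc_sentence) : bool := @fpc_eval [::] [::] phi tt tt.

End Eval.

(* Main.v *)
Require Import Defs.
From mathcomp Require Import all_boot all_order all_fingroup all_algebra cyclic zify.

Set Implicit Arguments.
Unset Strict Implicit.
Unset Printing Implicit Defensive.

(** Over F_2, [det A = 1] iff A is invertible, iff [A ^+ #|GL_n(F_2)| = 1] by
    Lagrange's theorem. The order of GL_n(F_2) is the product over 1 <= i <= n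
    of (2^i - 1) 2^(n-i), so this power is reached from A in n passes of n
    squarings each, the i-th pass multiplying by the result of the previous one
    during its first i squarings. A product of matrices over F_2 needs no
    ordering of the indices: its entries are parities of cardinalities. An
    inflationary fixpoint, with the pass and the squaring as numerical
    arguments, therefore computes the power. *)

Import GRing.Theory.
Local Open Scope ring_scope.

(* No monotonicity of [F] is available: in the intended uses [F] computes an
   entry negatively from entries of smaller rank, once these are all known. *)
Lemma ifp_ranked (T : finType) (F : {set T} -> {set T}) (S : {set T})
    (rk : T -> nat) :
  (forall X : {set T}, X \subset S -> F X \subset S) ->
  (forall (X : {set T}) t, X \subset S -> t \in S ->
    (forall u, u \in S -> (rk u < rk t)%N -> u \in X) -> t \in F X) ->
  ifp F = S.
Proof.
move=> sound progress.
have stage_sub n : ifp_stage F n \subset S.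
  elim: n => [|n IHn]; first exact: sub0set.
  by rewrite /= subUset IHn sound.
have stage_sup n t : t \in S -> (rk t < n)%N -> t \in ifp_stage F n.
  elim: n t => // n IHn t tS lt_t; rewrite /= inE; apply/orP; right.
  apply: progress => // u uS lt_u; apply: IHn => //; lia.
pose n := (#|T| + \max_t (rk t).+1)%N.
rewrite -(@ifp_stable _ F n) ?leq_addr //; apply/eqP; rewrite eqEsubset stage_sub.
apply/subsetP=> t tS; apply: stage_sup => //; apply: leq_trans (leq_addl _ _).
exact: (leq_bigmax (F := fun t => (rk t).+1)).
Qed.

(** * Numerical formulas: constants, parity and order *)

Section Syntax.
Variables (R : seq (seq fpc_sort)) (G : seq fpc_sort).

(** [var [::] s] is empty: both constructors build nonempty contexts, for which the [return] clause
    asks only for [unit]. *)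
Definition tnil s (x : var [::] s) : fpc_term R G s :=
  match x in var G0 s0
    return match G0 with [::] => fpc_term R G s0 | _ => unit end
  with VZ _ _ => tt | VS _ _ _ _ => tt end.

Definition tcons s a (t : fpc_term R G s) (ts : forall s, var a s -> fpc_term R G s)
    s' (x : var (s :: a) s') : fpc_term R G s' :=
  match x in var G0 s0
    return match G0 with
           | [::] => unit
           | s1 :: a1 => fpc_term R G s1 ->
               (forall s, var a1 s -> fpc_term R G s) -> fpc_term R G s0
           end
  with VZ _ _ => fun t _ => t | VS _ _ _ y => fun _ ts => ts _ y end t ts.

Definition FIff (p q : fpc_form R G) := FOr (FAnd p q) (FAnd (FNot p) (FNot q)).
End Syntax.

Local Notation "$0" := (TVar _ (VZ _ _)).
Local Notation "$1" := (TVar _ (VS _ (VZ _ _))).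
Local Notation "$2" := (TVar _ (VS _ (VS _ (VZ _ _)))).
Local Notation "$3" := (TVar _ (VS _ (VS _ (VS _ (VZ _ _))))).
Local Notation "$4" := (TVar _ (VS _ (VS _ (VS _ (VS _ (VZ _ _)))))).
Local Notation "$6" := (TVar _ (VS _ (VS _ (VS _ (VS _ (VS _ (VS _ (VZ _ _)))))))).

Definition TTop R G : fpc_term R G Nu := TCard (FEq $0 $0).
Definition TZero R G : fpc_term R G Nu := TCard (FNot (FEq $0 $0)).

(** The least set containing 1 and closed under adding 2, tested on the count of [p]. As [p] occurs
    only in the argument, outside the scope of the fixpoint variable, it needs no lifting. *)
Definition FOdd R G (p : fpc_form R (Pt :: G)) : fpc_form R G :=
  @FIfp R G [:: Nu]
    (FEx (s := Nu) (FAnd (FSucc $0 $1)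
      (FOr (FEq $0 (TZero _ _))
        (FEx (s := Nu) (FAnd (FSucc $0 $1) (FRel (VZ _ _) (tcons $0 (@tnil _ _))))))))
    (tcons (TCard p) (@tnil _ _)).

Definition FLt R G (t u : fpc_term R G Nu) : fpc_form R G :=
  @FIfp R G [:: Nu; Nu]
    (FOr (FSucc $0 $1)
      (FEx (s := Nu) (FAnd (FSucc $0 $2)
        (FRel (VZ _ _) (tcons $1 (tcons $0 (@tnil _ _)))))))
    (tcons t (tcons u (@tnil _ _))).

Section Eval.
Variables (I : finType) (E : rel I).

Lemma eval_TTop R G (r : renv I R) (e : env I G) :
  fpc_teval E (TTop R G) r e = ord_max.
Proof.
by apply: val_inj => /=; apply: eq_card => d; rewrite !inE; apply: eqxx.
Qed.

Lemma eval_TZero R G (r : renv I R) (e : env I G) :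
  fpc_teval E (TZero R G) r e = ord0.
Proof.
by apply: val_inj => /=; apply: eq_card0 => d; rewrite !inE; apply/negbF/eqxx.
Qed.

Lemma eval_FIff R G (p q : fpc_form R G) (r : renv I R) (e : env I G) :
  fpc_eval E (FIff p q) r e = (fpc_eval E p r e == fpc_eval E q r e).
Proof. by rewrite /=; do 2 case: fpc_eval. Qed.

Opaque TTop TZero FIff.

Lemma eval_FOdd R G (p : fpc_form R (Pt :: G)) (r : renv I R) (e : env I G) :
  fpc_eval E (FOdd p) r e =
    odd #|[pred d : I | @fpc_eval _ E _ (Pt :: G) p r (d, e)]|.
Proof.
rewrite /FOdd /= (@ifp_ranked _ _ [set t : env I [:: Nu] | odd (t.1 : 'I_#|I|.+1)]
  (fun t => t.1 : 'I_#|I|.+1)) ?inE //.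
- move=> X /subsetP sub_X; apply/subsetP=> -[k []]; rewrite !inE /=.
  case/existsP=> j /andP[/eqP kE]; rewrite kE eval_TZero.
  case/orP=> [/eqP-> //|/existsP[i /andP[/eqP jE /sub_X]]].
  by rewrite inE jE /= negbK.
- move=> X [[k lt_k] []] _; rewrite !inE /= => odd_k prog.
  case: k lt_k odd_k prog => [|[|k]] // lt_k odd_k prog.
    by apply/existsP; exists ord0; rewrite eqxx eval_TZero.
  apply/existsP; exists (Ordinal (ltnW lt_k)); rewrite eqxx /=.
  apply/orP; right; apply/existsP; exists (Ordinal (ltnW (ltnW lt_k))).
  by rewrite eqxx /=; apply: prog; rewrite ?inE //=; move: odd_k; rewrite /= negbK.
Qed.

Lemma eval_FLt R G (t u : fpc_term R G Nu) (r : renv I R) (e : env I G) :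
  fpc_eval E (FLt t u) r e =
    ((fpc_teval E t r e : 'I_#|I|.+1) < (fpc_teval E u r e : 'I_#|I|.+1))%N.
Proof.
(* The rank is the upper bound, since (i, j + 1) is derived from (i, j). *)
rewrite /FLt /= (@ifp_ranked _ _
  [set t : env I [:: Nu; Nu] | (t.1 : 'I_#|I|.+1) < (t.2.1 : 'I_#|I|.+1)]%N
  (fun t => t.2.1 : 'I_#|I|.+1)) ?inE //.
- move=> X /subsetP sub_X; apply/subsetP=> -[i [j []]]; rewrite !inE /=.
  case/orP=> [/eqP-> //|/existsP[k /andP[/eqP jE /sub_X]]].
  by rewrite inE jE /= => /ltnW.
- move=> X [i [[j lt_j] []]] _; rewrite !inE /= => lt_ij prog.
  case: j lt_j lt_ij prog => // j lt_j; rewrite ltnS leq_eqVlt.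
  case/predU1P=> [-> //|lt_ij prog]; first by rewrite eqxx.
  apply/orP; right; apply/existsP; exists (Ordinal (ltnW lt_j)).
  by rewrite eqxx /=; apply: prog; rewrite ?inE /=.
Qed.
End Eval.

Opaque TTop TZero FIff FOdd FLt.

(** * The exponent as the order of the general linear group *)

(* Exponent of A after [j] squarings in pass [i], when the previous pass ended
   with exponent [e]. *)
Fixpoint pass_exp (e i j : nat) : nat :=
  if j is j'.+1 then (2 * pass_exp e i j' + (if j' < i then e else 0))%N else 0%N.

Fixpoint gl_exp (n i : nat) : nat -> nat :=
  if i is i'.+1 then pass_exp (gl_exp n i' n) i else fun=> 1%N.

(** The first [i] squarings iterate m -> 2m + e from 0, giving e(2^k - 1) after k of them; the
    remaining ones only double. *)
Lemma pass_expE e i j :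
  (i <= j)%N -> pass_exp e i j = (e * ((2 ^ i - 1) * 2 ^ (j - i)))%N.
Proof.
have below k : (k <= i)%N -> pass_exp e i k = (e * (2 ^ k - 1))%N.
  elim: k => [|k IHk] lt_k /=; first by rewrite muln0.
  rewrite lt_k IHk ?(ltnW lt_k) // expnS.
  have : (0 < 2 ^ k)%N by rewrite expn_gt0.
  by rewrite mulnCA -{2}[e]muln1 -mulnDr => ?; congr (_ * _)%N; lia.
elim: j => [|j IHj]; rewrite leq_eqVlt.
  by rewrite orbF => /eqP->; rewrite expn0 subnn mul0n muln0.
case/predU1P=> [<-|le_ij]; first by rewrite below // subnn muln1.
rewrite [LHS]/= IHj // ltnNge -ltnS le_ij addn0 subSn // expnS.
by rewrite mulnCA (mulnCA 2).
Qed.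

(** The factors 2^(n-i) of the passes collect to 2^C(n,2), which gives the shape of [card_GL]. *)
Lemma gl_expE (n : nat) : gl_exp n n n =
  (2 ^ 'C(n, 2) * \prod_(1 <= i < n.+1) (2 ^ i - 1))%N.
Proof.
have gl_exp_prod i : (i <= n)%N ->
    gl_exp n i n = (\prod_(1 <= k < i.+1) ((2 ^ k - 1) * 2 ^ (n - k)))%N.
  elim: i => [|i IHi] le_i; first by rewrite big_geq.
  rewrite [LHS](pass_expE (gl_exp n i n)) // IHi ?(ltnW le_i) //.
  by rewrite [RHS]big_nat_recr.
rewrite gl_exp_prod // big_split /= mulnC -expn_sum; congr (2 ^ _ * _)%N.
by rewrite -bin2_sum [RHS]big_nat_rev big_add1.
Qed.

Lemma F2_neq0 (a : 'F_2) : (a != 0) = (a == 1).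
Proof. by case: a => [[|[|a]]]. Qed.

Lemma F2_eq_natb (a : 'F_2) : a = (a == 1)%:R.
Proof. by move: a => [[|[|a]] ?] //; apply: val_inj. Qed.

Lemma F2_natb_eq1 (b : bool) : (b%:R == 1 :> 'F_2) = b.
Proof. by case: b. Qed.

Lemma F2_mulE (a b : 'F_2) : a * b = ((a == 1) && (b == 1))%:R.
Proof. by rewrite {1}[a]F2_eq_natb {1}[b]F2_eq_natb -natrM mulnb. Qed.

(** Conversely to Lagrange, a matrix with a positive power equal to 1 is a unit. Size 0 is treated
    apart, as [card_GL] requires a positive size; there both sides hold. *)
Lemma det_F2_eq1 (n : nat) (A : 'M['F_2]_n) :
  (\det A == 1) = (A ^+ gl_exp n n n == 1).
Proof.
case: n A => [|n] A; first by rewrite det_mx00 [A]flatmx0 [1 in RHS]flatmx0 !eqxx.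
have cardG := @card_GL 'F_2 n.+1 isT.
rewrite card_Fp // -gl_expE in cardG.
have exp_gt0 : (0 < gl_exp n.+1 n.+1 n.+1)%N by rewrite -cardG cardG_gt0.
rewrite -F2_neq0 -unitfE -unitmxE; apply/idP/eqP=> [UA|AX].
  pose u : {'GL_n.+1['F_2]} := Sub A UA.
  have := congr1 val (expg_cardG (in_setT u)).
  by rewrite cardG FinRing.val_unitX.
by rewrite -[_ \in _](unitrX_pos _ exp_gt0) AX unitr1.
Qed.

Lemma mulmx_F2_odd (I : finType) (A B : 'M['F_2]_#|I|) (x y : I) :
  ((A * B) (enum_rank x) (enum_rank y) == 1) =
  odd #|[pred z | (A (enum_rank x) (enum_rank z) == 1) &&
                  (B (enum_rank z) (enum_rank y) == 1)]|.
Proof.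
rewrite mxE (reindex _ (onW_bij _ (@enum_rank_bij I))) /=.
under eq_bigr => z _ do rewrite F2_mulE.
rewrite -natr_sum -big_mkcond sum1_card -F2_neq0.
by rewrite -(dvdn_pcharf (pchar_Fp (isT : prime 2))) dvdn2 negbK.
Qed.

(** * The fixpoint formula for the power *)

(* A tuple (i, j, x, y, b) gives the entry (x, y) of the matrix after [j]
   squarings in pass [i]: the entry is 1 if b = 0, and 0 for any other b. So an
   entry that is 0 differs from one that is not computed yet. *)
Definition power_sorts := [:: Nu; Nu; Pt; Pt; Nu].

Section PowerFormula.
Variable R : seq (seq fpc_sort).
Notation Rx := (power_sorts :: R).

Definition FEntry G i j x y b : fpc_form Rx G :=
  FRel (VZ _ _) (tcons (s := Nu) i (tcons (s := Nu) j (tcons (s := Pt) x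
    (tcons (s := Pt) y (tcons (s := Nu) b (@tnil _ _)))))).

(** [TTop] is a sample nonzero b: it differs from 0 because [I] has a point as soon as there is an
    entry to test. *)
Definition FKnown G i j x y : fpc_form Rx G :=
  FOr (FEntry i j x y (TZero _ _)) (FEntry i j x y (TTop _ _)).

(* The context is j', i', i, j, x, y, b with i = i' + 1 and j = j' + 1. *)
Definition FPowerNext G : fpc_form Rx [:: Nu, Nu & power_sorts ++ G] :=
  FOdd (FAnd
    (FOdd (FAnd (FEntry $4 $2 $6 $0 (TZero _ _))
                (FEntry $4 $2 $0 $1 (TZero _ _))))
    (FOr (FAnd (FLt $1 $3) (FEntry $2 (TTop _ _) $0 $6 (TZero _ _)))
         (FAnd (FNot (FLt $1 $3)) (FEq $0 $6)))).

(** The disjuncts are pass 0, constantly A; the start of a later pass, the identity; and one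
    squaring. The last waits until both matrices it reads are fully known: a parity over a partial
    matrix may be wrong, and an inflationary stage never retracts. *)
Definition FPowerStep G : fpc_form Rx (power_sorts ++ G) :=
  FOr (FAnd (FEq $0 (TZero _ _)) (FIff (FEq $4 (TZero _ _)) (FEdge $2 $3)))
  (FOr (FAnd (FNot (FEq $0 (TZero _ _))) (FAnd (FEq $1 (TZero _ _))
    (FIff (FEq $4 (TZero _ _)) (FEq $2 $3))))
  (FEx (s := Nu) (FEx (s := Nu)
    (FAnd (FAnd (FSucc $1 $2) (FSucc $0 $3))
    (FAnd (FAll (s := Pt) (FAll (s := Pt)
            (FAnd (FKnown $4 $2 $1 $0) (FKnown $3 (TTop _ _) $1 $0))))
      (FIff (FEq $6 (TZero _ _)) (FPowerNext G))))))).
End PowerFormula.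

Definition FLastPower : fpc_form [::] [:: Pt; Pt] :=
  FIfp (G := [:: Pt; Pt]) (FPowerStep _ _) (tcons (TTop _ _) (tcons (TTop _ _)
    (tcons $1 (tcons $0 (tcons (TZero _ _) (@tnil _ _)))))).

Definition FDet : fpc_sentence :=
  FAll (s := Pt) (FAll (s := Pt) (FIff FLastPower (FEq $1 $0))).

(** * Correctness of the formula *)

Section PowerEval.
Variables (I : finType) (E : rel I) (A : 'M['F_2]_#|I|).
Hypothesis AE : forall x y, (A (enum_rank x) (enum_rank y) == 1) = E x y.

Definition power_entry i j x y :=
  (A ^+ gl_exp #|I| i j) (enum_rank x) (enum_rank y) == 1.

Definition power_graph : {set env I power_sorts} :=
  [set t | (t.2.2.2.2.1 == ord0 :> 'I_#|I|.+1) ==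
    power_entry (t.1 : 'I_#|I|.+1) (t.2.1 : 'I_#|I|.+1) t.2.2.1 t.2.2.2.1].

Lemma power_entry0 j x y : power_entry 0 j x y = E x y.
Proof. by rewrite /power_entry expr1 AE. Qed.

Lemma power_entryS0 i x y : power_entry i.+1 0 x y = (x == y).
Proof. by rewrite /power_entry expr0 mxE F2_natb_eq1 (inj_eq enum_rank_inj). Qed.

(** The exponent 2m + e splits the power into a square times a third factor, which is the identity
    once the first [i.+1] squarings are over. *)
Lemma power_entrySS i j x y :
  power_entry i.+1 j.+1 x y =
    odd #|[pred z | odd #|[pred w | power_entry i.+1 j x w && power_entry i.+1 j w z]|
       && ((j < i.+1)%N && power_entry i #|I| z y || ~~ (j < i.+1)%N && (z == y))]|.
Proof.
have -> : power_entry i.+1 j.+1 x y =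
    ((A ^+ gl_exp #|I| i.+1 j * A ^+ gl_exp #|I| i.+1 j *
      (if (j < i.+1)%N then A ^+ gl_exp #|I| i #|I| else 1))
      (enum_rank x) (enum_rank y) == 1).
  by rewrite /power_entry /= exprD mulnC exprM expr2; case: ifP.
rewrite mulmx_F2_odd; congr odd; apply: eq_card => z; rewrite !inE mulmx_F2_odd.
congr (_ && _); case: ifP => _ /=; first by rewrite orbF.
by rewrite mxE F2_natb_eq1 (inj_eq enum_rank_inj).
Qed.

Lemma eval_FPowerNext R G (r : renv I R) (e : env I G)
    (X : {set env I power_sorts})
    (i i' j j' b : 'I_#|I|.+1) (x y : I) :
  i = i'.+1 :> nat ->
  (forall u v, ((i, (j', (u, (v, (ord0, tt))))) \in X) = power_entry i j' u v) ->
  (forall u v, ((i', (ord_max, (u, (v, (ord0, tt))))) \in X)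
     = power_entry i' #|I| u v) ->
  @fpc_eval _ E (power_sorts :: R) [:: Nu, Nu & power_sorts ++ G] (FPowerNext R G)
    (X, r) (j', (i', (i, (j, (x, (y, (b, e))))))) = power_entry i j'.+1 x y.
Proof.
move=> iE XE X'E; rewrite iE power_entrySS -iE eval_FOdd; congr odd.
apply: eq_card => z; rewrite !inE /= eval_FOdd !eval_FLt !eval_TTop !eval_TZero /=.
rewrite X'E; congr (odd _ && _).
by apply: eq_card => w; rewrite !inE /= !eval_TZero !XE.
Qed.

Lemma mem_power_graph (i j b : 'I_#|I|.+1) (x y : I) :
  ((i, (j, (x, (y, (b, tt))))) \in power_graph) = ((b == ord0) == power_entry i j x y).
Proof. by rewrite inE. Qed.

Lemma power_knownP (X : {set env I power_sorts}) (i j : 'I_#|I|.+1) (x y : I) :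
  X \subset power_graph ->
  ((i, (j, (x, (y, (ord0, tt))))) \in X) || ((i, (j, (x, (y, (ord_max, tt))))) \in X) ->
  ((i, (j, (x, (y, (ord0, tt))))) \in X) = power_entry i j x y.
Proof.
move=> /subsetP sub_X known; apply/idP/idP=> [/sub_X|xy].
  by rewrite mem_power_graph eqxx => /eqP<-.
(* If the entry is 1, soundness of [X] forces [ord_max] to equal [ord0], so the known tuple is
   already the wanted one. *)
case/orP: known => // maxX; have := sub_X _ maxX.
by rewrite mem_power_graph xy => /eqP/eqP max0; rewrite -max0.
Qed.

Lemma power_known (X : {set env I power_sorts}) (i j : 'I_#|I|.+1) (x y : I) :
  (forall b : 'I_#|I|.+1, (i, (j, (x, (y, (b, tt))))) \in power_graph ->
    (i, (j, (x, (y, (b, tt))))) \in X) ->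
  ((i, (j, (x, (y, (ord0, tt))))) \in X) || ((i, (j, (x, (y, (ord_max, tt))))) \in X).
Proof.
move=> sup_X; case xy: (power_entry i j x y); apply/orP; [left | right].
  by apply: sup_X; rewrite mem_power_graph xy.
apply: sup_X; rewrite mem_power_graph xy eqbF_neg -val_eqE /= -lt0n.
by apply/card_gt0P; exists x.
Qed.

Lemma ifp_power R G (r : renv I R) (e : env I G) :
  ifp (fun X : {set env I power_sorts} =>
    [set t | @fpc_eval _ E (power_sorts :: R) _ (FPowerStep R G) (X, r) (env_cat t e)])
  = power_graph.
Proof.
(* Lexicographic rank on (i, j): as j is at most [#|I|], the end of a pass ranks below all of the
   next pass. *)
apply: (@ifp_ranked _ _ _ (fun t : env I power_sorts =>
  ((t.1 : 'I_#|I|.+1) * #|I|.+1 + (t.2.1 : 'I_#|I|.+1))%N)).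
- move=> X sub_X; apply/subsetP=> -[i [j [x [y [b []]]]]].
  rewrite mem_power_graph inE /= !eval_FIff /= !eval_TZero.
  case/or3P=> [/andP[/eqP-> /eqP->]|/and3P[i0 /eqP-> /eqP->]|].
  + by rewrite power_entry0.
  + by case: i i0 => -[|i] // lt_i _; rewrite /= power_entryS0.
  case/existsP=> i' /existsP[j' /and3P[/andP[/eqP iE /eqP jE] known]].
  (* The guard upgrades soundness of [X] to exactness on the two matrices that are read. *)
  have {}known u v : ((i, (j', (u, (v, (ord0, tt))))) \in X) = power_entry i j' u v /\
     ((i', (ord_max, (u, (v, (ord0, tt))))) \in X) = power_entry i' #|I| u v.
    move/forallP/(_ u)/forallP/(_ v): known; rewrite !eval_TZero !eval_TTop.
    by case/andP=> /(power_knownP sub_X) -> /(power_knownP sub_X) ->.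
  rewrite eval_FIff /= eval_TZero eval_FPowerNext ?jE //.
  + by move=> u v; case: (known u v).
  + by move=> u v; case: (known u v).
- move=> X [i [j [x [y [b []]]]]] sub_X; rewrite mem_power_graph => /eqP bE prog.
  rewrite inE /= !eval_FIff /= !eval_TZero bE.
  case: i prog bE => -[|i] lt_i prog bE.
    by apply/or3P/Or31; rewrite power_entry0 !eqxx.
  case: j prog bE => -[|j] lt_j prog bE.
    by apply/or3P/Or32; rewrite power_entryS0 !eqxx.
  apply/or3P/Or33/existsP; exists (Ordinal (ltnW lt_i)).
  apply/existsP; exists (Ordinal (ltnW lt_j)); rewrite /= !eqxx /=.
  have known u v b' :
      (Ordinal lt_i, (Ordinal (ltnW lt_j), (u, (v, (b', tt))))) \in power_graph ->
      (Ordinal lt_i, (Ordinal (ltnW lt_j), (u, (v, (b', tt))))) \in X.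
    by move=> uv; apply: prog => //=; rewrite ltn_add2l.
  have known' u v b' :
      (Ordinal (ltnW lt_i), (ord_max, (u, (v, (b', tt))))) \in power_graph ->
      (Ordinal (ltnW lt_i), (ord_max, (u, (v, (b', tt))))) \in X.
    by move=> uv; apply: prog => //=; rewrite mulSn; lia.
  apply/andP; split.
    apply/forallP=> u; apply/forallP=> v; rewrite !eval_TZero !eval_TTop.
    by rewrite !power_known // => b'; [apply: known' | apply: known].
  rewrite eval_FIff /= eval_TZero bE; apply/eqP; rewrite eval_FPowerNext //= => u v.
    by apply: power_knownP => //; apply: power_known => b'; apply: known.
  by apply: power_knownP => //; apply: power_known => b'; apply: known'.
Qed.

Lemma fpc_holds_FDet : fpc_holds E FDet = (\det A == 1).
Proof.
rewrite det_F2_eq1 /fpc_holds.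
have entry_det x y :
    @fpc_eval _ E _ [:: Pt; Pt] FLastPower tt (y, (x, tt)) = power_entry #|I| #|I| x y.
  rewrite [LHS]/= (@ifp_power [::] [:: Pt; Pt] tt).
  by rewrite !eval_TTop !eval_TZero mem_power_graph eqxx; case: power_entry.
transitivity [forall x : I, forall y : I,
    @fpc_eval _ E _ [:: Pt; Pt] (FIff FLastPower (FEq $1 $0)) tt (y, (x, tt))] => //.
transitivity [forall x : I, forall y : I, power_entry #|I| #|I| x y == (x == y)].
  by apply: eq_forallb => x; apply: eq_forallb => y; rewrite eval_FIff entry_det.
apply/forallP/eqP=> [entryE|AX x].
  apply/matrixP=> i j; rewrite -(enum_valK i) -(enum_valK j).
  have /forallP/(_ (enum_val j))/eqP := entryE (enum_val i).
  rewrite /power_entry mxE (inj_eq enum_rank_inj).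
  by move=> <-; apply: F2_eq_natb.
apply/forallP=> y; rewrite /power_entry AX.
by rewrite mxE F2_natb_eq1 (inj_eq enum_rank_inj).
Qed.
End PowerEval.

Theorem mainTheorem8 :
  exists phi : fpc_sentence,
    forall (I : finType) (E : rel I) (M : I -> I -> 'F_2),
      (forall i j : I, M i j = 1 <-> E i j) ->
      (fpc_holds E phi <-> detI M = 1).
Proof.
(* The enumeration of [I] enters only through this matrix, the one inside [detI]; the sentence
   itself is order-free. *)
exists FDet => I E M ME; rewrite (@fpc_holds_FDet _ _
  (\matrix_(i, j) M (enum_val i) (enum_val j))).
  by split=> /eqP.
by move=> x y; rewrite mxE !enum_rankK; apply/eqP/idP=> /ME.
Qed.
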